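(* Let $r\geq 2$, $n>r^{8}$ and $0<\alpha<\frac{1}{36r^{8}}$. If a graph $G$ of order $n$ satisfies $$e(G)>\left(\frac{r-1}{2r}-\alpha\right)n^{2},$$ then either $$js^{(2,r+1,2)}(G)>\left(1-\frac{1}{r^{3}}\right)\frac{n^{r-1}}{r^{r+5}},$$ or $G$ contains an induced subgraph $G_0$ with chromatic number at most $r$, of order at least $(1-2\sqrt{\alpha})n$, and with minimum degree $$\delta(G_0)>\left(1-\frac1r-6\sqrt{\alpha}\right)n.$$
   Context: All graphs are finite and simple; $e(G)$ is the number of edges and $\delta(G)$ the minimum degree. For an integer $r\geq 2$, $js^{(2,r+1,2)}(G)$ is the maximum, over all edges $uv$ of $G$, of the number of $(r+1)$-cliques of $G$ containing both $u$ and $v$ (and $0$ if $G$ has no edges). *)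

(* Defs.v *)
From mathcomp Require Import all_boot all_order all_algebra.
From mathcomp Require Export reals.
Set Implicit Arguments. Unset Strict Implicit. Unset Printing Implicit Defensive.
Import Order.TTheory GRing.Theory Num.Theory.

Definition simple_graph (T : finType) (e : rel T) : Prop :=
  symmetric e /\ irreflexive e.

Definition is_clique (T : finType) (e : rel T) (K : {set T}) : bool :=
  [forall x in K, forall y in K, (x != y) ==> e x y].

Definition num_edges (T : finType) (e : rel T) : nat :=
  #|[set A : {set T} | (#|A| == 2) && is_clique e A]|.

Definition cliques_through (T : finType) (e : rel T) (s : nat) (u v : T) : nat :=
  #|[set K : {set T} | [&& is_clique e K, #|K| == s, u \in K & v \in K]]|.

(* js^{(2,r+1,2)}(G): max over edges uv of the number of (r+1)-cliques containing u and v;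
   0 if there are no edges. *)
Definition js_2r2 (T : finType) (e : rel T) (r : nat) : nat :=
  \max_(p : T * T | e p.1 p.2) cliques_through e r.+1 p.1 p.2.

Definition induced_colorable (T : finType) (e : rel T) (S : {set T}) (k : nat) : Prop :=
  exists f : T -> 'I_k, forall x y, x \in S -> y \in S -> e x y -> f x != f y.

Definition deg_in (T : finType) (e : rel T) (S : {set T}) (x : T) : nat :=
  #|[set y in S | e x y]|.

(* Main.v *)
(** Call a vertex low if its degree is at most (1 - 1/r - 4 sqrt alpha) n, and
suppose that no edge lies in many (r+1)-cliques.

A vertex set U in which every degree exceeds (1 - 1/r - 1/r^4) |U| is then
r-colourable. Indeed, averaging the codegrees of the pairs of an (r+1)-clique
gives an edge whose codegree is so large that it extends greedily to many
(r+1)-cliques; so U spans no (r+1)-clique, and above this degree a clique-free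
graph is r-colourable because adjacent vertices have few common non-neighbours
(an easy range of the Andrasfai-Erdos-Sos theorem). If at most 2 sqrt alpha n
vertices are low, this applies to the set of the other vertices.

Otherwise delete about 2 sqrt alpha n low vertices (one, if sqrt alpha n < 1/2).
The remaining set U0 has about (1 - 1/r) |U0|^2 / 2 edges or more. Among its
large subsets U, maximise e(U) - (1 - 1/r - beta) |U|^2 / 2 for a constant beta
of order r^-4. If the maximiser is as small as allowed, it is so dense that
Moon-Moser supersaturation gives an edge in many (r+1)-cliques. If not,
maximality bounds its degrees from below, so it is r-colourable, and counting
its edges shows that it is U0. But the number of edges of U0, or integrality
when a single vertex is deleted, excludes that U0 is r-colourable. *)

Require Import Defs.
From mathcomp Require Import all_boot all_order all_algebra.
From mathcomp Require Import reals.
From mathcomp Require Import zify ring lra.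
Import Order.TTheory GRing.Theory Num.Theory.
Local Open Scope ring_scope.

Set Implicit Arguments. Unset Strict Implicit. Unset Printing Implicit Defensive.

(** * Double counting of cliques *)

Section Cliques.
Local Open Scope nat_scope.
Variables (T : finType) (e : rel T).
Hypothesis (e_sym : symmetric e) (e_irr : irreflexive e).
Implicit Types (U W C K M Q : {set T}) (s k r : nat) (u v w x y : T).

Definition cliques U s := [set K : {set T} | [&& is_clique e K, K \subset U & #|K| == s]].

Definition common_nbrs U C := [set v in U | [forall c in C, e c v]].

(** For irreflexive [e], a vertex [x] of [U] belongs to its own set; in a complete multipartite
    graph on [U] this set is the part of [x]. *)
Definition non_nbrs U x := [set y in U | ~~ e x y].

Lemma is_cliqueP C :
  reflect {in C &, forall x y, x != y -> e x y} (is_clique e C).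
Proof.
apply: (iffP idP) => [h x y xC yC xy|h].
  by move/forallP/(_ x)/implyP/(_ xC)/forallP/(_ y)/implyP/(_ yC)/implyP/(_ xy): h.
apply/forallP => x; apply/implyP => xC; apply/forallP => y.
by apply/implyP => yC; apply/implyP; apply: h.
Qed.

Lemma common_nbrsP U C v :
  reflect (v \in U /\ {in C, forall c, e c v}) (v \in common_nbrs U C).
Proof.
rewrite inE; apply: (iffP andP) => -[vU h]; split=> //.
  by move=> c cC; move/forallP/(_ c)/implyP/(_ cC): h.
by apply/forallP => c; apply/implyP/h.
Qed.

Lemma common_nbrs_notin U C v : v \in common_nbrs U C -> v \notin C.
Proof.
by case/common_nbrsP => _ h; apply/negP => /h; rewrite e_irr.
Qed.

Lemma clique_setU1 U C v :
  is_clique e C -> v \in common_nbrs U C -> is_clique e (v |: C).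
Proof.
move=> /is_cliqueP clC /common_nbrsP[_ h]; apply/is_cliqueP => x y.
case/setU1P=> [->|xC]; case/setU1P=> [->|yC].
- by rewrite eqxx.
- by rewrite e_sym; move=> _; apply: h.
- by move=> _; apply: h.
- exact: clC.
Qed.

Lemma cliques_setU1 U s C v :
  C \in cliques U s -> v \in common_nbrs U C -> v |: C \in cliques U s.+1.
Proof.
rewrite inE => /and3P[clC CU /eqP <-] hv.
rewrite inE (clique_setU1 clC hv) cardsU1 (common_nbrs_notin hv) eqxx andbT.
by rewrite subUset sub1set CU andbT; case/common_nbrsP: hv.
Qed.

Lemma cliques_setU U s k C Q :
  C \in cliques U s -> Q \in cliques (common_nbrs U C) k ->
  C :|: Q \in cliques U (s + k).
Proof.
rewrite !inE => /and3P[/is_cliqueP clC CU /eqP cC] /and3P[/is_cliqueP clQ /subsetP QW /eqP cQ].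
have hQ x : x \in Q -> x \in U /\ {in C, forall c, e c x}.
  by move=> /QW /common_nbrsP.
apply/and3P; split.
- apply/is_cliqueP => x y; case/setUP=> hx; case/setUP=> hy; [exact: clC| | |exact: clQ].
  + by move=> _; case: (hQ y hy) => _; apply.
  + by move=> _; rewrite e_sym; case: (hQ x hx) => _; apply.
- by rewrite subUset CU; apply/subsetP => x /hQ[].
- rewrite cardsU cC cQ (_ : C :&: Q = set0) ?cards0 ?subn0 //.
  apply/setP => x; rewrite !inE; apply/negP => /andP[xC /hQ[_ /(_ x xC)]].
  by rewrite e_irr.
Qed.

Lemma cliques2 U x y :
  x \in U -> y \in U -> e x y -> [set x; y] \in cliques U 2.
Proof.
move=> xU yU xy; rewrite inE cards2 (_ : x != y); last first.
  by apply: contraTneq xy => ->; rewrite e_irr.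
rewrite eqxx andbT; apply/andP; split; last by rewrite subUset !sub1set xU.
apply/is_cliqueP => u v.
by rewrite !inE => /orP[] /eqP-> /orP[] /eqP-> //; rewrite ?eqxx // e_sym.
Qed.

Lemma cliques1 U x : x \in U -> [set x] \in cliques U 1.
Proof.
move=> xU; rewrite inE cards1 sub1set xU !andbT; apply/is_cliqueP => u v.
by rewrite !inE => /eqP-> /eqP->; rewrite eqxx.
Qed.

Lemma sub_clique C K : C \subset K -> is_clique e K -> is_clique e C.
Proof.
move=> /subsetP CK /is_cliqueP h; apply/is_cliqueP => x y xC yC.
by apply: h; apply: CK.
Qed.

Lemma cliques_setD1 U s K v :
  K \in cliques U s.+1 -> v \in K ->
  (K :\ v \in cliques U s) && (v \in common_nbrs U (K :\ v)).
Proof.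
rewrite inE => /and3P[clK /subsetP KU /eqP cK] vK.
apply/andP; split.
  rewrite inE (sub_clique (subsetDl K [set v]) clK) /=.
  have := cardsD1 v K; rewrite vK cK add1n => -[<-]; rewrite eqxx andbT.
  by apply/subsetP => x /setD1P[_ /KU].
apply/common_nbrsP; split; first exact: KU.
by move=> c /setD1P[cv cK']; move/is_cliqueP: clK; apply.
Qed.

(** The map [(C, v)] to [(v |: C, v)] is a bijection from s-cliques with a common neighbour onto
    (s+1)-cliques with a marked vertex. *)
Lemma sum_cliques_ext U s (F : {set T} -> T -> nat) :
  \sum_(K in cliques U s.+1) \sum_(v in K) F (K :\ v) v =
  \sum_(C in cliques U s) \sum_(v in common_nbrs U C) F C v.
Proof.
rewrite !pair_big_dep /=.
rewrite (reindex_onto (fun q : {set T} * T => (q.2 |: q.1, q.2))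
                      (fun q : {set T} * T => (q.1 :\ q.2, q.2))) /=; last first.
  by case=> K v /= /andP[_ vK]; rewrite setD1K.
apply: eq_big => [[C v]|[C v]] /=.
  apply/idP/idP.
    case/andP=> /andP[hK _] /eqP[hC].
    by have := cliques_setD1 hK (setU11 v C); rewrite hC.
  case/andP=> hC hv; rewrite (cliques_setU1 hC hv) setU11 /=.
  by rewrite setU1K ?eqxx // (common_nbrs_notin hv).
by case/andP=> _ /eqP[->].
Qed.

Lemma card_cliques_succ U s :
  s.+1 * #|cliques U s.+1| = \sum_(C in cliques U s) #|common_nbrs U C|.
Proof.
under [RHS]eq_bigr do rewrite -sum1_card.
rewrite -sum_cliques_ext mulnC -sum_nat_const; apply: eq_bigr => K.
by rewrite sum1_card inE => /and3P[_ _ /eqP->].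
Qed.

Lemma cliques0 U : cliques U 0 = [set set0].
Proof.
apply/setP => K; rewrite !inE cards_eq0; case: eqP => [->|]; rewrite ?andbF //.
by rewrite sub0set !andbT; apply/is_cliqueP => x y; rewrite inE.
Qed.

Lemma common_nbrs0 U : common_nbrs U set0 = U.
Proof.
by apply/setP => v; rewrite inE; case: (v \in U) => //=; apply/forallP => c; rewrite inE.
Qed.

Lemma card_cliques1 U : #|cliques U 1| = #|U|.
Proof. by have := card_cliques_succ U 0; rewrite cliques0 big_set1 common_nbrs0 mul1n. Qed.

(** * Common neighbours, degree sums and the Turan bound *)

Lemma card_non_nbrs U x : (deg_in e U x + #|non_nbrs U x| = #|U|)%N.
Proof.
rewrite /deg_in -[RHS](cardsID [set y | e x y]); congr (_ + _).
  by apply: eq_card => y; rewrite !inE.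
by apply: eq_card => y; rewrite !inE andbC.
Qed.

(** Union bound: a vertex of [W] outside [common_nbrs W C] is a non-neighbour of some [c] in [C]. *)
Lemma card_common_nbrs_ge U W C :
  W \subset U -> #|W| <= #|common_nbrs W C| + \sum_(c in C) #|non_nbrs U c|.
Proof.
move=> /subsetP WU.
have h : W \subset common_nbrs W C :|: \bigcup_(c in C) non_nbrs U c.
  apply/subsetP => x xW; rewrite !inE xW /=.
  case: (boolP [forall c in C, e c x]) => //= /forallPn[c].
  rewrite negb_imply => /andP[cC hc]; apply/bigcupP; exists c => //.
  by rewrite inE hc andbT WU.
apply: leq_trans (subset_leq_card h) _; apply: leq_trans (leq_card_setU _ _) _.
rewrite leq_add2l.
elim/big_rec2: _ => [|c m S cC hm]; first by rewrite cards0.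
by apply: leq_trans (leq_card_setU _ _) _; rewrite leq_add2l.
Qed.

(** A vertex of [U] adjacent to all of [K] is counted [#|K|] times. Any other vertex misses some [c]
    in [K], so it can only be counted for [v = c]. *)
Lemma sum_common_nbrs_setD1 U K :
  K != set0 ->
  \sum_(v in K) #|common_nbrs U (K :\ v)| <= #|U| + #|K|.-1 * #|common_nbrs U K|.
Proof.
move=> K0.
have -> : \sum_(v in K) #|common_nbrs U (K :\ v)| =
   \sum_(w in U) \sum_(v in K | w \in common_nbrs U (K :\ v)) 1.
  under eq_bigr do rewrite -sum1_card.
  rewrite (exchange_big_dep (mem U)) /=; last by move=> v w _ /common_nbrsP[].
  by [].
have -> : #|U| + #|K|.-1 * #|common_nbrs U K| =
   \sum_(w in U) (1 + #|K|.-1 * (w \in common_nbrs U K)).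
  rewrite big_split /= sum1_card -big_distrr /=; congr (_ + _ * _).
  rewrite -sum1_card big_mkcond [RHS]big_mkcond /=; apply: eq_bigr => w _.
  case: (boolP (w \in common_nbrs U K)) => [/common_nbrsP[-> _] //|_].
  by rewrite if_same.
apply: leq_sum => w wU; rewrite sum1_card.
case: (boolP (w \in common_nbrs U K)) => hw.
  rewrite muln1 add1n prednK ?card_gt0 //.
  by apply: subset_leq_card; apply/subsetP => v /andP[].
rewrite muln0 addn0.
have [c cK hc] : exists2 c, c \in K & ~~ e c w.
  move: hw; rewrite inE wU /= => /forallPn[c]; rewrite negb_imply => /andP[cK hc].
  by exists c.
rewrite -(cards1 c); apply: subset_leq_card; apply/subsetP => v /andP[vK /common_nbrsP[_ h]].
rewrite inE eq_sym; apply: contraR hc => cv; apply: h; rewrite !inE cv //.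
Qed.

Lemma sum_deg_in U : \sum_(x in U) deg_in e U x = 2 * #|cliques U 2|.
Proof.
have e1 : cliques U 1 = [set [set x] | x in U].
  apply/eqP; rewrite eq_sym eqEcard card_cliques1 card_imset; last exact: set1_inj.
  rewrite leqnn andbT; apply/subsetP => _ /imsetP[x xU ->].
  exact: cliques1.
rewrite card_cliques_succ e1 big_imset /=; last by move=> x y _ _; apply: set1_inj.
apply: eq_bigr => x _; apply: eq_card => y; rewrite !inE; congr (_ && _).
apply/idP/forallP => [h c|/(_ x)]; last by rewrite !inE eqxx.
by rewrite inE; apply/implyP => /eqP->.
Qed.

Lemma num_edges_cliques : num_edges e = #|cliques [set: T] 2|.
Proof. by apply: eq_card => A; rewrite !inE subsetT andbC. Qed.

Lemma leq_cliques_through_js r u v :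
  e u v -> cliques_through e r.+1 u v <= js_2r2 e r.
Proof. by move=> uv; apply: (@bigop.leq_bigmax_cond _ (fun p : T * T => e p.1 p.2) _ (u, v)). Qed.

(** Each edge between [M] and the rest contributes at both ends, whence the factor 2; edges inside
    [M] are overcounted, whence an inequality. *)
Lemma sum_deg_in_setD U M :
  M \subset U ->
  \sum_(x in U) deg_in e U x <=
  \sum_(x in U :\: M) deg_in e (U :\: M) x + 2 * \sum_(x in M) deg_in e U x.
Proof.
move=> MU; rewrite (big_setID M) /= (setIidPr MU) mulSn mul1n addnA addnC leq_add2r.
have -> : \sum_(x in M) deg_in e U x = \sum_(y in U) deg_in e M y.
  rewrite /deg_in; under eq_bigr do rewrite -sum1_card.
  rewrite (exchange_big_dep (mem U)) /=; last by move=> x y _; rewrite inE => /andP[].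
  apply: eq_bigr => y yU; rewrite sum1_card; apply: eq_card => x.
  by rewrite !inE unfold_in /= !inE yU e_sym.
rewrite (@big_setID _ _ _ _ U M) /= (setIidPr MU).
apply: leq_trans (_ : \sum_(y in U :\: M) (deg_in e (U :\: M) y + deg_in e M y) <= _).
  apply: leq_sum => x _; rewrite addnC /deg_in -(cardsID M [set y in U | e x y]).
  by apply: leq_add; apply: subset_leq_card; apply/subsetP => y;
     rewrite !inE; case: (y \in U); case: (y \in M); case: (e x y).
by rewrite big_split /= leq_add2l leq_addl.
Qed.

Lemma common_nbrs1 U x : #|common_nbrs U [set x]| = deg_in e U x.
Proof.
apply: eq_card => y; apply/common_nbrsP/idP => [[yU h]|].
  by rewrite inE yU h ?set11.
by rewrite inE => /andP[yU xy]; split=> // c /set1P->.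
Qed.

Lemma card_common_nbrs2 U x y :
  #|common_nbrs U [set x; y]| + #|non_nbrs U x :|: non_nbrs U y| = #|U|.
Proof.
rewrite -[RHS](cardsID (common_nbrs U [set x; y])); congr (_ + _).
  apply: eq_card => z; rewrite [RHS]inE andb_idl //.
  by case/common_nbrsP.
apply: eq_card => z; rewrite !inE; case: (z \in U) => //=.
rewrite andbT -negb_and; congr (~~ _).
apply/andP/forallP => [[xz yz] c|h].
  by rewrite !inE; apply/implyP => /orP[] /eqP->.
by split; [move: (h x)|move: (h y)]; rewrite !inE eqxx ?orbT.
Qed.

(** A vertex misses its own colour class, so the degree sum plus the sum of the squared class sizes
    is at most [#|U| ^ 2]. The term in [#|U| %% r] records that the class sizes are integers. *)
Lemma colorable_deg_bound U r (f : T -> 'I_r) :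
  0 < r ->
  {in U &, forall x y, e x y -> f x != f y} ->
  r * (\sum_(x in U) deg_in e U x) + (#|U| %% r) * (r - #|U| %% r) <=
  (r - 1) * #|U| ^ 2.
Proof.
move=> r0 hf; pose n i := #|[set x in U | f x == i]|.
have sn : \sum_(i < r) n i = #|U|.
  rewrite -sum1_card (partition_big f xpredT) //=; apply: eq_bigr => i _.
  by rewrite sum1_card; apply: eq_card => x; rewrite inE.
have h1 : \sum_(x in U) deg_in e U x + \sum_(i < r) n i * n i <= #|U| ^ 2.
  have -> : \sum_(i < r) n i * n i = \sum_(x in U) n (f x).
    rewrite (partition_big f xpredT) //=; apply: eq_bigr => i _.
    rewrite (eq_bigr (fun=> n i)); last by move=> x /andP[_ /eqP->].
    by rewrite sum_nat_const; congr (_ * _); apply: eq_card => x; rewrite inE.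
  rewrite -big_split -mulnn -sum_nat_const /=; apply: leq_sum => x xU.
  rewrite -(card_non_nbrs U x) leq_add2l; apply: subset_leq_card.
  apply/subsetP => y; rewrite !inE => /andP[yU /eqP fy]; rewrite yU /=.
  by apply/negP => /(hf x y xU yU); rewrite fy eqxx.
pose q := #|U| %/ r.
(* Summand by summand this is [(n i - q) * (n i - q - 1) >= 0], valid for integers. *)
have h2 : (2 * q + 1) * #|U| <= \sum_(i < r) n i * n i + r * (q * q.+1).
  have -> : r * (q * q.+1) = \sum_(i < r) q * q.+1 by rewrite sum_nat_const card_ord.
  rewrite -sn big_distrr /= -big_split /=; apply: leq_sum => i _.
    by case: (leqP (n i) q); nia.
have := divn_eq #|U| r; rewrite -/q; have := ltn_pmod #|U| r0.
move: (#|U| %% r) h1 h2 => s; move: (\sum_(x in U) _) (\sum_(i < r) _) => E2 S.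
move: #|U| q => N q h1 h2 hs hN; subst N.
nia.
Qed.

End Cliques.

(** * Many cliques on one edge *)

Section Counting.
Variables (R : realFieldType) (T : finType) (e : rel T).
Hypothesis (e_sym : symmetric e) (e_irr : irreflexive e).
Implicit Types (U W C K M : {set T}) (s k r : nat) (u v w x y : T).

(** ['C(k, s) * D ^ s] is the number of s-cliques of a complete k-partite graph with parts of size
    [D], which satisfies the hypothesis with equality. *)
Lemma binomial_chain (c : nat -> R) (D : R) k :
  0 <= D -> c 0%N = 1 ->
  (forall s, (s < k)%N -> (k - s)%:R * D * c s <= s.+1%:R * c s.+1) ->
  forall s, (s <= k)%N -> 'C(k, s)%:R * D ^+ s <= c s.
Proof.
move=> D0 c0 h; elim=> [|s IH] sk; first by rewrite bin0 expr0 mulr1 c0.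
rewrite -(ler_pM2l (ltr0Sn R s)) mulrA -natrM mul_bin_left.
apply: le_trans (h s sk); rewrite exprS natrM -!mulrA.
apply: ler_wpM2l => //; rewrite mulrCA; apply: ler_wpM2l => //.
exact/IH/ltnW.
Qed.

Section BoundedNonNbrs.
Variables (U : {set T}) (D : R).
Hypothesis non_nbrs_le : {in U, forall x, #|non_nbrs e U x|%:R <= D}.

Lemma card_common_nbrs_geR W C :
  W \subset U -> C \subset U ->
  #|W|%:R - #|C|%:R * D <= #|common_nbrs e W C|%:R.
Proof.
move=> WU /subsetP CU.
have := card_common_nbrs_ge e C WU; rewrite -(ler_nat R) natrD => h.
rewrite lerBlDr; apply: le_trans h _; rewrite lerD2l natr_sum.
rewrite mulr_natl -sumr_const; apply: ler_sum => c cC.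
exact/non_nbrs_le/CU.
Qed.

Lemma cliques_succ_ge W s :
  W \subset U ->
  (#|W|%:R - s%:R * D) * #|cliques e W s|%:R <= s.+1%:R * #|cliques e W s.+1|%:R.
Proof.
move=> WU; rewrite -natrM card_cliques_succ // natr_sum mulr_natr -sumr_const.
apply: ler_sum => C; rewrite inE => /and3P[_ CW /eqP <-].
apply: card_common_nbrs_geR => //; exact: subset_trans WU.
Qed.

(** Greedy extension: an s-clique with [s < k] extends in at least [(k - s) * D] ways, giving
    [D ^ k] cliques of size k, each of which extends in at least [#|W| - k * D] ways. *)
Lemma cliques_ge W k :
  W \subset U -> 0 <= D -> k%:R * D <= #|W|%:R ->
  (#|W|%:R - k%:R * D) * D ^+ k <= k.+1%:R * #|cliques e W k.+1|%:R.
Proof.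
move=> WU D0 kD.
apply: le_trans (cliques_succ_ge k WU); apply: ler_wpM2l; first by rewrite subr_ge0.
have := binomial_chain (c := fun s => #|cliques e W s|%:R) D0 _ _ (leqnn k).
rewrite binn mul1r; apply; first by rewrite cliques0 cards1.
move=> s sk; apply: le_trans (cliques_succ_ge s WU).
by apply: ler_wpM2r => //; rewrite natrB ?(ltnW sk) // mulrBl lerD2r.
Qed.

Lemma cliques_neq0 W k :
  W \subset U -> 0 < D -> k%:R * D < #|W|%:R -> cliques e W k.+1 != set0.
Proof.
move=> WU D0 kD; have := cliques_ge WU (ltW D0) (ltW kD).
apply: contraTneq => ->; rewrite cards0 mulr0 -ltNge.
by rewrite mulr_gt0 ?exprn_gt0 ?subr_gt0.
Qed.

End BoundedNonNbrs.

(** * Moon-Moser inequalities and supersaturation *)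

(* With a_C the number of common neighbours of C, this sums (a_C - lam)^2 >= 0. *)
Lemma moon_moser_step U s (lam : R) :
  0 <= lam -> lam * #|cliques e U s|%:R <= s.+1%:R * #|cliques e U s.+1|%:R ->
  (lam * s.+1%:R - #|U|%:R) * #|cliques e U s.+1|%:R <=
    s%:R * (s.+2%:R * #|cliques e U s.+2|%:R).
Proof.
move=> lam0 hlam.
have hsq : lam * (s.+1%:R * #|cliques e U s.+1|%:R) <=
    \sum_(C in cliques e U s) (#|common_nbrs e U C|%:R : R) ^+ 2.
  have h : \sum_(C in cliques e U s)
      (2 * lam * #|common_nbrs e U C|%:R - lam ^+ 2) <=
      \sum_(C in cliques e U s) (#|common_nbrs e U C|%:R : R) ^+ 2.
    apply: ler_sum => C _; rewrite -subr_ge0.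
    have := sqr_ge0 (#|common_nbrs e U C|%:R - lam); lra.
  apply: le_trans h; rewrite sumrB -big_distrr /= sumr_const -natr_sum.
  rewrite -card_cliques_succ // natrM -mulr_natr.
  have := ler_wpM2l lam0 hlam; lra.
(* The sum of the squares of the a_C is a sum over (s+1)-cliques [K] of the common neighbour counts
   of the sets [K :\ v], bounded by [sum_common_nbrs_setD1]. *)
have hnat : (\sum_(C in cliques e U s) #|common_nbrs e U C| ^ 2 <=
    #|U| * #|cliques e U s.+1| + s * (s.+2 * #|cliques e U s.+2|))%N.
  under eq_bigr => C _ do rewrite -mulnn -sum_nat_const.
  rewrite -(sum_cliques_ext e_sym e_irr U s (fun C _ => #|common_nbrs e U C|)).
  rewrite card_cliques_succ // big_distrr /= mulnC -sum_nat_const -big_split /=.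
  apply: leq_sum => K; rewrite inE => /and3P[_ _ /eqP cK].
  have := sum_common_nbrs_setD1 e U (K := K); rewrite cK /=; apply.
  by rewrite -card_gt0 cK.
rewrite mulrBl lerBlDl; apply: le_trans (_ : _ <= _); last first.
  move: hnat; rewrite -(ler_nat R) natr_sum natrD !natrM => hnat.
  apply: le_trans hnat.
  by under eq_bigr do rewrite natrX; exact: hsq.
by rewrite mulrA.
Qed.

(** Induction on [s]: the bound for [s] serves as [lam] in [moon_moser_step], and [(s + 1) * (1 - s
    * y) - 1 = s * (1 - (s + 1) * y)] reproduces its form. The degree sum enters only at [s = 1]. *)
Lemma moon_moser U (y : R) s :
  (1 - y) * #|U|%:R ^+ 2 <= (\sum_(x in U) deg_in e U x)%:R ->
  s%:R * y <= 1 ->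
  (1 - s%:R * y) * #|U|%:R * #|cliques e U s|%:R <= s.+1%:R * #|cliques e U s.+1|%:R.
Proof.
move=> hy; elim: s => [|[|s] IH] hs.
- by rewrite cliques0 cards1 card_cliques1 // mul0r subr0 !mul1r mulr1.
- rewrite card_cliques1 // mul1r -mulrA -expr2; apply: le_trans hy _.
  by rewrite sum_deg_in // natrM.
have hs' : s.+1%:R * y <= 1.
  have [y0|y0] := leP 0 y.
    by apply: le_trans hs; apply: ler_wpM2r; rewrite // ler_nat.
  apply: le_trans (_ : 0 <= 1) => //; apply: mulr_ge0_le0 => //; exact: ltW.
have lam0 : 0 <= (1 - s.+1%:R * y) * #|U|%:R by rewrite mulr_ge0 ?subr_ge0.
have := moon_moser_step lam0 (IH hs') => hmm.
rewrite -(ler_pM2l (ltr0Sn R s)); apply: le_trans hmm.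
rewrite le_eqVlt; apply/orP; left; apply/eqP; rewrite -(natr1 s.+1) -(natr1 s); ring.
Qed.

Lemma sum_cliques_through U s :
  (s.+1 * s * #|cliques e U s.+1| <=
   \sum_(u in U) \sum_(v in U | e u v) cliques_through e s.+1 u v)%N.
Proof.
have -> : (s.+1 * s * #|cliques e U s.+1| =
    \sum_(K in cliques e U s.+1) \sum_(u in K) \sum_(v in K :\ u) 1)%N.
  rewrite mulnC -sum_nat_const; apply: eq_bigr => K.
  rewrite inE => /and3P[_ _ /eqP cK]; rewrite -{1}cK -sum_nat_const.
  apply: eq_bigr => u uK; rewrite sum1_card.
  by have := cardsD1 u K; rewrite uK cK add1n => -[].
rewrite (exchange_big_dep (mem U)) /=; last first.
  by move=> K u; rewrite inE => /and3P[_ /subsetP KU _] /KU.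
apply: leq_sum => u uU; rewrite (exchange_big_dep (fun v => (v \in U) && e u v)) /=.
  apply: leq_sum => v /andP[vU uv]; rewrite sum1_card /cliques_through.
  apply: subset_leq_card; apply/subsetP => K /andP[/andP[]].
  rewrite !inE => /and3P[-> _ ->] -> /andP[_ ->] //.
move=> K v /andP[]; rewrite inE => /and3P[/is_cliqueP clK /subsetP KU _] uK.
rewrite !inE => /andP[vu vK]; rewrite KU //=; apply: clK => //; by rewrite eq_sym.
Qed.

Lemma cliques_le_js U r :
  (r.+1 * r * #|cliques e U r.+1| <= #|U| ^ 2 * js_2r2 e r)%N.
Proof.
apply: leq_trans (sum_cliques_through U r) _.
rewrite -mulnn -mulnA -sum_nat_const; apply: leq_sum => u uU.
rewrite -sum_nat_const big_mkcondr /=; apply: leq_sum => v _.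
case: ifP => // uv; exact: leq_cliques_through_js.
Qed.

(** With [y = 1 / r - 2 * g], the Moon-Moser ratios below size r dominate those of the balanced
    complete r-partite graph, so there are at least [(#|U| / r) ^ r] r-cliques. The next ratio,
    [1 - r * y = 2 * g * r], gives the (r+1)-cliques, which are averaged over ordered pairs of
    vertices. *)
Lemma supersaturation U r (g : R) :
  (0 < r)%N -> 0 <= g -> (0 < #|U|)%N ->
  (1 - 1 / r%:R + 2 * g) * #|U|%:R ^+ 2 <= (\sum_(x in U) deg_in e U x)%:R ->
  2 * g * r%:R * (#|U|%:R / r%:R) ^+ r.-1 <= (js_2r2 e r)%:R.
Proof.
case: r => // r _ g0 U0 hE.
set N : R := #|U|%:R in hE *; have N0 : 0 < N by rewrite /N ltr0n.
set q : R := r.+1%:R in hE *; have q0 : 0 < q by rewrite /q ltr0n.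
have qE : r.+1%:R = q by []; clearbody q.
pose y := 1 / q - 2 * g.
have hy : q * y = 1 - 2 * g * q.
  rewrite /y; field. exact: lt0r_neq0.
have hE' : (1 - y) * N ^+ 2 <= (\sum_(x in U) deg_in e U x)%:R.
  by apply: le_trans hE; rewrite /y opprB addrA addrAC.
have gq : 0 <= 2 * g * q by rewrite !mulr_ge0 // ltW.
have hys s : s%:R * y <= s%:R / q.
  by rewrite ler_wpM2l // /y div1r lerBlDr lerDl; lra.
have hs1 s : (s <= r.+1)%N -> s%:R * y <= 1.
  by move=> sr; apply: le_trans (hys s) _; rewrite ler_pdivrMr // mul1r -qE ler_nat.
have hr : (N / q) ^+ r.+1 <= #|cliques e U r.+1|%:R.
  have := binomial_chain (c := fun s => #|cliques e U s|%:R) (D := N / q) _ _ _ (leqnn r.+1).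
  rewrite binn mul1r; apply; first by rewrite divr_ge0 // ltW.
    by rewrite cliques0 cards1.
  move=> s sr; apply: le_trans (moon_moser hE' (hs1 _ (ltnW sr))).
  apply: ler_wpM2r => //; rewrite mulrCA mulrC ler_pM2r //.
  rewrite natrB ?(ltnW sr) // qE mulrBl divff ?gt_eqF // lerD2l lerN2; exact: hys.
have hr1 := moon_moser hE' (hs1 _ (leqnn _)).
have := cliques_le_js U r.+1; rewrite -(ler_nat R) !natrM -/N -expr2 qE => hjs.
have h2 : 2 * g * q * N * (N / q) ^+ r.+1 <= r.+2%:R * #|cliques e U r.+2|%:R.
  apply: le_trans hr1; rewrite qE -/N hy opprB addrC subrK.
  by apply: ler_wpM2l => //; rewrite mulr_ge0 // ltW.
have h3 : N ^+ 2 * (2 * g * q * (N / q) ^+ r) <= N ^+ 2 * (js_2r2 e r.+1)%:R.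
  apply: le_trans hjs; rewrite -[X in _ <= X]mulrA [X in _ <= X]mulrCA.
  apply: le_trans (ler_wpM2l (ltW q0) h2).
  rewrite [(N / q) ^+ r.+1]exprS; move: ((N / q) ^+ r) => z.
  rewrite le_eqVlt; apply/orP; left; apply/eqP; field.
  exact: lt0r_neq0.
by move: h3; rewrite ler_pM2l ?exprn_gt0.
Qed.

(** * An edge of large codegree inside a clique *)

Lemma sum_codegrees U K :
  K \subset U ->
  (\sum_(u in K) \sum_(v in K :\ u) #|common_nbrs e U [set u; v]| =
   \sum_(w in U) deg_in e K w * (deg_in e K w).-1)%N.
Proof.
move=> /subsetP KU.
under eq_bigr do under eq_bigr do rewrite -sum1_card.
under eq_bigr => u uK.
  rewrite (exchange_big_dep (mem U)) /=; last by move=> v w _ /common_nbrsP[].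
  over.
rewrite exchange_big /=; apply: eq_bigr => w wU.
rewrite (bigID (fun u => e w u)) /= [X in (_ + X)%N]big1 ?addn0; last first.
  move=> u /andP[uK wu]; apply: big1 => v /andP[_ /common_nbrsP[_ h]].
  by move: wu; rewrite e_sym h // setU11.
rewrite -[X in (X * _)%N]sum1_card big_distrl /=.
apply: eq_big => [u|u /andP[uK wu]]; first by rewrite inE.
rewrite mul1n sum1_card.
have := cardsD1 u [set y in K | e w y]; rewrite inE uK wu add1n /deg_in => -> /=.
apply: eq_card => v; rewrite [RHS]inE unfold_in /= !inE wU /=.
rewrite -andbA; congr (_ && (_ && _)).
apply/forallP/idP => [/(_ v)|wv c].
  by rewrite !inE eqxx orbT e_sym.
by rewrite !inE e_sym; apply/implyP => /orP[] /eqP->.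
Qed.

Lemma sum_deg_in_sym U K :
  K \subset U -> (\sum_(w in U) deg_in e K w = \sum_(u in K) deg_in e U u)%N.
Proof.
move=> /subsetP KU; rewrite /deg_in.
under eq_bigr do rewrite -sum1_card.
rewrite (exchange_big_dep (mem K)) /=; last by move=> x y _; rewrite inE => /andP[].
apply: eq_bigr => y yK; rewrite sum1_card; apply: eq_card => x.
by rewrite !inE unfold_in /= !inE yK e_sym.
Qed.

(** Average over the [r * (r + 1)] ordered pairs of [K]: a vertex with d neighbours in [K]
    contributes [d * (d - 1)]. This is bounded below by the linear function agreeing with it at
    [d = r - 1] and [d = r]; for [D = #|U| / r] the average of d is at least [r - 1 / r], between
    these two values. *)
Lemma clique_edge_codegree U K r (D : R) :
  K \in cliques e U r.+1 ->
  {in U, forall x, #|non_nbrs e U x|%:R <= D} ->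
  (0 < r)%N ->
  exists u v, [/\ u \in U, v \in U, e u v &
    (r%:R - 1) * ((r%:R + 2) * #|U|%:R - 2 * (r%:R + 1) * D) <=
    r%:R * (r%:R + 1) * #|common_nbrs e U [set u; v]|%:R].
Proof.
rewrite inE => /and3P[/is_cliqueP clK KU /eqP cK] hD r0.
have r1 : 1 <= r%:R :> R by rewrite ler1n.
pose cod u v : R := #|common_nbrs e U [set u; v]|%:R.
set lhs := (X in exists u v, [/\ _, _, _ & X <= _]).
suff hsum : lhs <= \sum_(u in K) \sum_(v in K :\ u) cod u v.
  have [/existsP[u /existsP[v /and4P[uK vK uv h]]]|hno] :=
     boolP [exists u, exists v, [&& u \in K, v \in K, u != v &
        lhs <= r%:R * (r%:R + 1) * cod u v]].
    by exists u, v; split; rewrite ?(subsetP KU) // clK.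
  have rr : 0 < r%:R * (r%:R + 1) :> R by nra.
  have cKv u : u \in K -> #|K :\ u| = r.
    by move=> uK; have := cardsD1 u K; rewrite uK cK add1n => -[].
  have : \sum_(u in K) \sum_(v in K :\ u) cod u v < lhs.
    have -> : lhs = \sum_(u in K) \sum_(v in K :\ u) (lhs / (r%:R * (r%:R + 1))).
      under eq_bigr => u uK do rewrite sumr_const cKv //.
      rewrite sumr_const cK -mulrnA -[RHS]mulr_natr natrM -(natr1 r).
      by rewrite divfK ?gt_eqF.
    have [u0 u0K] : exists u, u \in K by apply/set0Pn; rewrite -card_gt0 cK.
    apply: ltr_sum; first by apply/hasP; exists u0; rewrite ?mem_index_enum.
    move=> u uK; apply: ltr_sum.
      have /set0Pn[v vK] : K :\ u != set0 by rewrite -card_gt0 cKv.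
      by apply/hasP; exists v; rewrite ?mem_index_enum.
    move=> v /setD1P[vu vK]; rewrite ltr_pdivlMr // mulrC ltNge.
    by move: hno; apply: contra => h; apply/existsP; exists u; apply/existsP;
       exists v; rewrite uK vK eq_sym vu h.
  by rewrite ltNge hsum.
have -> : \sum_(u in K) \sum_(v in K :\ u) cod u v =
    (\sum_(u in K) \sum_(v in K :\ u) #|common_nbrs e U [set u; v]|)%N%:R.
  by rewrite natr_sum; apply: eq_bigr => u _; rewrite natr_sum.
rewrite sum_codegrees // natr_sum.
(* Equivalent to (d - r) (d - r + 1) >= 0 for the integer d = deg_in e K w. *)
have hw w : w \in U -> 2 * (r%:R - 1) * (deg_in e K w)%:R - r%:R * (r%:R - 1)
     <= (deg_in e K w * (deg_in e K w).-1)%:R :> R.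
  move=> _; case: (deg_in e K w) => [|d] /=; first by rewrite mul0n; nra.
  have [rd|dr] := leqP r d.+1.
    have : r%:R <= d.+1%:R :> R by rewrite ler_nat.
    rewrite natrM -natr1 => rd'; have rd2 : 0 <= d%:R + 1 - r%:R :> R by lra.
    have : 0 <= (d%:R + 1 - r%:R) * (d%:R + 2 - r%:R) :> R by apply: mulr_ge0; lra.
    lra.
  have : d.+2%:R <= r%:R :> R by rewrite ler_nat.
  rewrite natrM -(natr1 d.+1) -(natr1 d) => dr'.
  have : 0 <= (r%:R - d%:R - 1) * (r%:R - d%:R - 2) :> R by apply: mulr_ge0; lra.
  lra.
apply: le_trans (ler_sum _ hw).
rewrite sumrB -big_distrr /= -natr_sum sum_deg_in_sym // natr_sum sumr_const.
have hdeg : (r%:R + 1) * (#|U|%:R - D) <= \sum_(u in K) (deg_in e U u)%:R.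
  rewrite natr1 -cK mulr_natl -sumr_const; apply: ler_sum => u uK.
  by rewrite lerBlDr -(card_non_nbrs e U u) natrD lerD2l hD // (subsetP KU).
have h2 : 0 <= 2 * (r%:R - 1) :> R by lra.
have := ler_wpM2l h2 hdeg; rewrite /lhs -mulr_natr; lra.
Qed.

Lemma cliques_le_through U r u v :
  u \in U -> v \in U -> e u v ->
  (#|cliques e (common_nbrs e U [set u; v]) r| <= cliques_through e r.+2 u v)%N.
Proof.
move=> uU vU uv; set W := common_nbrs _ _ _.
have f_inj : {in cliques e W r &, injective (fun K => [set u; v] :|: K)}.
  move=> K L; rewrite !inE => /and3P[_ KW _] /and3P[_ LW _].
  have dW (Z : {set T}) : Z \subset W -> ([set u; v] :|: Z) :\: [set u; v] = Z.
    move=> /subsetP ZW; apply/setP => x; rewrite setDUl setDv set0U inE.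
    by case: (boolP (x \in Z)) => [/ZW /(common_nbrs_notin e_irr)->|]; rewrite ?andbF.
  by move=> /(congr1 (fun A => A :\: [set u; v])); rewrite !dW.
rewrite -(card_in_imset f_inj); apply: subset_leq_card.
apply/subsetP => _ /imsetP[K KW ->].
have := cliques_setU e_sym e_irr (cliques2 e_sym e_irr uU vU uv) KW.
by rewrite !inE add2n => /and3P[-> _ ->]; rewrite !eqxx !orbT.
Qed.

(** The edge from [clique_edge_codegree] has a common neighbourhood in which (r-1)-cliques are built
    greedily. The nonnegativity hypothesis ensures that this neighbourhood has at least
    [(r - 2) * D] vertices. *)
Lemma js_ge_of_clique U r (D : R) :
  (1 < r)%N -> 0 <= D ->
  {in U, forall x, #|non_nbrs e U x|%:R <= D} ->
  cliques e U r.+1 != set0 ->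
  0 <= 2 * D - (r%:R - 1) * (r%:R + 2) * (r%:R * D - #|U|%:R) ->
  (2 * D - (r%:R - 1) * (r%:R + 2) * (r%:R * D - #|U|%:R)) * D ^+ (r - 2)
    <= (r%:R - 1) * (r%:R * (r%:R + 1)) * (js_2r2 e r)%:R.
Proof.
case: r => [|[|r]] // _ D0 hD /set0Pn[K hK] hc.
have [u [v [uU vU uv hcod]]] := clique_edge_codegree hK hD isT.
set q : R := r.+2%:R in hc hcod *.
have qE : r%:R = q - 2 by rewrite /q -(natr1 r.+1) -(natr1 r); ring.
have q2 : 2 <= q by rewrite /q ler_nat.
set W := common_nbrs e U [set u; v] in hcod *.
have WU : W \subset U by apply/subsetP => x /common_nbrsP[].
have qq : 0 < q * (q + 1) by nra.
have hW : 2 * D - (q - 1) * (q + 2) * (q * D - #|U|%:R) <=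
          q * (q + 1) * (#|W|%:R - r%:R * D).
  rewrite qE; lra.
have hW0 : r%:R * D <= #|W|%:R.
  by rewrite -subr_ge0 -(pmulr_rge0 _ qq); apply: le_trans hW.
have := cliques_ge hD WU D0 hW0; rewrite subn2 /= => h1.
have h2 : #|cliques e W r.+1|%:R <= (js_2r2 e r.+2)%:R :> R.
  rewrite ler_nat; apply: leq_trans (leq_cliques_through_js _ uv).
  exact: cliques_le_through.
have h3 : r.+1%:R = q - 1 by rewrite -natr1 qE; ring.
apply: le_trans (ler_wpM2r (exprn_ge0 r D0) hW) _.
rewrite -[X in X <= _]mulrA [(q - 1) * _]mulrC -[X in _ <= X]mulrA.
apply: ler_wpM2l; first exact: ltW.
apply: le_trans h1 _; rewrite h3; apply: ler_wpM2l => //; lra.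
Qed.

End Counting.

(** * Colouring clique-free graphs of large minimum degree *)

Section Coloring.
Variables (R : realFieldType) (T : finType) (e : rel T).
Hypothesis (e_sym : symmetric e) (e_irr : irreflexive e).
Variables (U : {set T}) (D : R) (r : nat).
Hypotheses (D_gt0 : 0 < D)
  (non_nbrs_le : {in U, forall x, #|non_nbrs e U x|%:R <= D})
  (clique_free : cliques e U r.+1 = set0).
(** The defect from the balanced complete r-partite graph, for which [t = 0] when [D] is the part
    size. *)
Let t : R := r%:R * D - #|U|%:R.
Let nn x := non_nbrs e U x.

(** A larger common neighbourhood would contain a clique on [r - j + 1] vertices, completing [C] to
    an (r+1)-clique. *)
Lemma common_nbrs_le C j :
  (j <= r)%N -> C \in cliques e U j -> #|common_nbrs e U C|%:R <= (r%:R - j%:R) * D.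
Proof.
move=> jr hC; rewrite leNgt; apply/negP; rewrite -natrB // => h.
have WU : common_nbrs e U C \subset U by apply/subsetP => x /common_nbrsP[].
have /set0Pn[Q hQ] := cliques_neq0 e_sym e_irr non_nbrs_le WU D_gt0 h.
have := cliques_setU e_sym e_irr hC hQ.
by rewrite addnS subnKC // clique_free inE.
Qed.

Lemma non_nbrs_ge x : (0 < r)%N -> x \in U -> D - t <= #|nn x|%:R.
Proof.
move=> r0 xU; have := common_nbrs_le r0 (cliques1 e xU).
have := card_non_nbrs e U x; rewrite common_nbrs1 -/(nn x) => /(congr1 (fun n => n%:R : R)).
rewrite natrD /t; lra.
Qed.

(** The case [j = 2] bounds the union of the two sets from below by [#|U| - (r - 2) * D], and their
    sizes sum to at most [2 * D]. *)
Lemma non_nbrs_adjacent x y :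
  (1 < r)%N -> x \in U -> y \in U -> e x y -> #|nn x :&: nn y|%:R <= t.
Proof.
move=> r1 xU yU xy; have := common_nbrs_le r1 (cliques2 e_sym e_irr xU yU xy).
have := card_common_nbrs2 e U x y; have := cardsUI (nn x) (nn y); rewrite -/(nn x) -/(nn y).
move=> /(congr1 (fun n => n%:R : R)); rewrite !natrD => h1.
move=> /(congr1 (fun n => n%:R : R)); rewrite !natrD => h2.
have := non_nbrs_le xU; have := non_nbrs_le yU; rewrite -/(nn x) -/(nn y) /t; lra.
Qed.

(** Fix an r-clique [Q]. As it has no common neighbour, every vertex misses some vertex of [Q], and
    all but at most [t] miss exactly one. This gives almost a partition into large independent sets
    [A u], which then dictates a colour for every vertex. *)
Lemma clique_free_colorable :
  (1 < r)%N -> (r%:R + 2) * t < D -> induced_colorable e U r.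
Proof.
move=> r1 ht; have r0 : (0 < r)%N := ltnW r1.
have rR : 2 <= r%:R :> R by rewrite ler_nat.
have [Q hQ] : exists Q, Q \in cliques e U r.
  apply/set0Pn; move: ht; rewrite /t -(prednK r0) -natr1 => ht.
  apply: (cliques_neq0 e_sym e_irr non_nbrs_le (subxx U) D_gt0).
  have rR' : 1 <= r.-1%:R :> R by rewrite ler1n -ltnS prednK.
  move: (r.-1%:R : R) rR' ht => k k1 ht; rewrite ltNge; apply/negP => h.
  have : 0 <= (k + 3) * (k * D - #|U|%:R) by apply: mulr_ge0; lra.
  have : 0 < (k + 2) * D by apply: mulr_gt0 => //; lra.
  lra.
have /and3P[/is_cliqueP clQ /subsetP QU /eqP cQ] : [&& is_clique e Q, Q \subset U & #|Q| == r].
  by move: hQ; rewrite inE.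
have nnQ x : x \in U -> (0 < #|nn x :&: Q|)%N.
  move=> xU; rewrite card_gt0; apply/set0Pn.
  have := common_nbrs_le (leqnn r) hQ; rewrite subrr mul0r lern0 cards_eq0 => /eqP W0.
  have : x \notin common_nbrs e U Q by rewrite W0 inE.
  rewrite inE xU /= => /forallPn[q]; rewrite negb_imply => /andP[qQ hq].
  by exists q; rewrite !inE QU // e_sym hq qQ.
have nn_sym x y : x \in U -> y \in nn x -> x \in nn y.
  by move=> xU; rewrite !inE xU e_sym => /andP[].
(* A vertex x gets the colour of some u in Q such that x has no neighbour in A u. *)
pose A u := [set x in U | nn x :&: Q == [set u]].
pose B := [set x in U | (1 < #|nn x :&: Q|)%N].
(* Pairs of [u] in [Q] and a non-neighbour [x] of [u]: each [x] occurs at least once, those in [B]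
   at least twice, and there are at most [r * D] pairs. *)
have tB : #|B|%:R <= t.
  have h : (#|U| + #|B| <= \sum_(u in Q) #|nn u|)%N.
    have -> : (\sum_(u in Q) #|nn u| = \sum_(x in U) #|nn x :&: Q|)%N.
      under eq_bigr do rewrite -sum1_card.
      rewrite (exchange_big_dep (mem U)) /=; last by move=> u x _; rewrite inE => /andP[].
      apply: eq_bigr => x xU; rewrite sum1_card; apply: eq_card => u.
      apply/andP/setIP => [[uQ ux]|[ux uQ]]; split=> //; apply: nn_sym => //.
      exact: QU.
    have -> : (#|U| + #|B| = \sum_(x in U) (1 + (1 < #|nn x :&: Q|)%N))%N.
      rewrite big_split /= sum1_card; congr (_ + _)%N.
      by rewrite -sum1dep_card big_mkcondr; apply: eq_bigr => x _; case: ifP.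
    apply: leq_sum => x xU; have := nnQ x xU.
    by case: (#|nn x :&: Q|) => [|[|n]].
  have : \sum_(u in Q) (#|nn u|%:R : R) <= r%:R * D.
    by rewrite -cQ mulr_natl -sumr_const; apply: ler_sum => u /QU/non_nbrs_le.
  by move: h; rewrite -(ler_nat R) natrD natr_sum /t; lra.
have t0 : 0 <= t by apply: le_trans tB.
have AU u x : x \in A u -> x \in U by rewrite inE => /andP[].
have AQ u x : x \in A u -> nn x :&: Q = [set u] by rewrite inE => /andP[_ /eqP].
have nnA u : u \in Q -> D - 2 * t <= #|A u|%:R.
  move=> uQ; have : nn u \subset A u :|: B.
    apply/subsetP => x xu; have xU : x \in U by move: xu; rewrite inE => /andP[].
    rewrite inE [x \in B]inE xU /= ltnNge orbC -implybE; apply/implyP => h.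
    rewrite inE xU eq_sym eqEcard cards1 h andbT sub1set inE uQ andbT.
    by apply: nn_sym => //; apply: QU.
  move/subset_leq_card/leq_trans/(_ (leq_card_setU _ _)).
  rewrite -(ler_nat R) natrD; have := non_nbrs_ge r0 (QU u uQ); lra.
(* An edge inside [A u] together with [Q :\ u] would be an (r+1)-clique. *)
have A_indep u y : u \in Q -> y \in A u -> A u \subset nn y.
  move=> uQ yA; apply/subsetP => z zA; rewrite inE (AU _ _ zA) /=; apply/negP => yz.
  have h q w : q \in Q :\ u -> w \in A u -> e w q.
    move=> /setD1P[qu qQ] wA; apply: contraNT qu => wq.
    by rewrite -in_set1 -(AQ _ _ wA) !inE (QU _ qQ) wq.
  have hQu : Q :\ u \in cliques e (common_nbrs e U [set y; z]) r.-1.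
    have := cardsD1 u Q; rewrite uQ cQ add1n => /(congr1 predn) /= cQu.
    rewrite inE -cQu eqxx andbT; apply/andP; split.
      by apply: (sub_clique (subsetDl Q [set u])); move: hQ; rewrite inE => /andP[].
    apply/subsetP => q qQ; apply/common_nbrsP; split; first by case/setD1P: qQ => _ /QU.
    by move=> w; rewrite !inE => /orP[] /eqP->; apply: h.
  have := cliques_setU e_sym e_irr (cliques2 e_sym e_irr (AU _ _ yA) (AU _ _ zA) yz) hQu.
  by rewrite add2n prednK // clique_free inE.
(* If [x] had a neighbour [y] in every [A u], then, as [A u] lies in [nn y], [x] would miss at most
   [t] vertices of each [A u]. So [nn x] would have at most [(r + 1) * t < D - t] elements. *)
have color x : x \in U -> exists2 u, u \in Q & [forall y in A u, ~~ e x y].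
  move=> xU; apply/exists_inP; apply: contraT => /exists_inPn hno.
  have hA u : u \in Q -> #|nn x :&: A u|%:R <= t.
    move=> uQ; have := hno u uQ => /forall_inPn[y yA]; rewrite negbK => xy.
    apply: le_trans (non_nbrs_adjacent r1 xU (AU _ _ yA) xy).
    by rewrite ler_nat; apply: subset_leq_card; apply: setIS; apply: A_indep.
  have h : (#|nn x| <= #|B| + \sum_(u in Q) #|nn x :&: A u|)%N.
    apply: (@leq_trans #|B :|: \bigcup_(u in Q) (nn x :&: A u)|).
      apply: subset_leq_card; apply/subsetP => y yx.
      have yU : y \in U by move: yx; rewrite inE => /andP[].
      rewrite inE [y \in B]inE yU /=; have [//|h1] := ltnP 1 #|nn y :&: Q|.
      have /eqP/cards1P[u hu] : #|nn y :&: Q| = 1%N by apply/eqP; rewrite eqn_leq h1 nnQ.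
      apply/bigcupP; exists u; last by rewrite !inE yU hu eqxx /= andbT; move: yx; rewrite inE yU.
      by have : u \in nn y :&: Q; [rewrite hu set11|case/setIP].
    apply: leq_trans (leq_card_setU _ _) _; rewrite leq_add2l.
    elim/big_rec2: _ => [|c m S cC hm]; first by rewrite cards0.
    by apply: leq_trans (leq_card_setU _ _) _; rewrite leq_add2l.
  have : \sum_(u in Q) (#|nn x :&: A u|%:R : R) <= r%:R * t.
    by rewrite -cQ mulr_natl -sumr_const; apply: ler_sum.
  move: h; rewrite -(ler_nat R) natrD natr_sum; have := non_nbrs_ge r0 xU; lra.
have [u0 u0Q] : exists u, u \in Q by apply/set0Pn; rewrite -card_gt0 cQ.
(* The default [u0] is reached only outside [U], by [color]. *)
pose g x := odflt u0 [pick u in Q | [forall y in A u, ~~ e x y]].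
exists (fun x => cast_ord cQ (enum_rank_in u0Q (g x))) => x y xU yU xy.
have gP z : z \in U -> g z \in Q /\ {in A (g z), forall w, ~~ e z w}.
  move=> zU; rewrite /g; case: pickP => [u /andP[uQ /forall_inP hu] //|hno].
  by have [u uQ hu] := color z zU; have := hno u; rewrite uQ hu.
have [gxQ gx] := gP x xU; have [gyQ gy] := gP y yU.
apply/negP => /eqP/cast_ord_inj/(congr1 enum_val); rewrite !enum_rankK_in // => gxy.
(* Adjacent vertices of one colour would both miss [A (g x)], which has at least [D - 2 * t > t]
   vertices. *)
have : A (g x) \subset nn x :&: nn y.
  apply/subsetP => w wA; rewrite !inE (AU _ _ wA) gx //=; apply: gy; by rewrite -gxy.
move/subset_leq_card; rewrite -(ler_nat R).
have := non_nbrs_adjacent r1 xU yU xy; have := nnA _ gxQ.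
nra.
Qed.

End Coloring.

(** * Stability *)

Lemma ge_1Mx_exprn (R : realDomainType) (x : R) k :
  0 <= x -> x <= 1 -> 1 - k%:R * x <= (1 - x) ^+ k.
Proof.
move=> x0 x1; elim: k => [|k IH]; first by rewrite expr0 mul0r subr0.
have x1' : 0 <= 1 - x by rewrite subr_ge0.
rewrite exprS -natr1; apply: le_trans (ler_wpM2l x1' IH).
have : 0 <= k%:R * x ^+ 2 by rewrite mulr_ge0 // sqr_ge0.
lra.
Qed.

Section Stability.
Variables (R : realFieldType) (T : finType) (e : rel T) (r : nat) (u : R).
Hypothesis (e_sym : symmetric e) (e_irr : irreflexive e) (r_ge2 : (2 <= r)%N).
(** [u] is 1/r; this equation keeps all later estimates polynomial in [u]. *)
Hypothesis (ru : r%:R * u = 1).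
Implicit Types (U : {set T}).
Local Notation n := (#|T|%:R : R).
Local Notation deg_sum U := ((\sum_(x in U) deg_in e U x)%:R : R).

Lemma inv_bounds : 0 < u /\ u <= 1 / 2.
Proof.
have h : 2 <= r%:R :> R by rewrite ler_nat.
have ru1 := ru.
have u0 : 0 < u.
  by rewrite -(pmulr_rgt0 _ (lt_le_trans _ h)) // ru1.
split=> //; have := ler_wpM2r (ltW u0) h; rewrite ru1; lra.
Qed.

(** Common last step of both sources of cliques. By Bernoulli, [(1 - u / 2) ^ (r - 1) >= 1 / 2], so
    the factor 2 pays for replacing [#|U|] by [n]; strictness comes from [1 - 1 / r ^ 3 < 1]. *)
Lemma js_large U :
  0 < n -> (1 - u / 2) * n <= #|U|%:R ->
  2 * u ^+ 6 * (#|U|%:R * u) ^+ r.-1 <= (js_2r2 e r)%:R ->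
  (1 - 1 / r%:R ^+ 3) * n ^+ (r - 1)%N / r%:R ^+ (r + 5)%N < (js_2r2 e r)%:R.
Proof.
move=> n0 hU; have [u0 u1] := inv_bounds; apply: lt_le_trans.
have r0 : 0 < r%:R :> R by rewrite ltr0n ltnW.
have uE : u = r%:R^-1 by apply: (mulfI (lt0r_neq0 r0)); rewrite ru mulfV ?lt0r_neq0.
have h1 : (r%:R ^+ (r + 5))^-1 = u ^+ r.-1 * u ^+ 6 :> R.
  by rewrite -exprVn -exprD uE; congr (_ ^+ _); lia.
have h2 : 2^-1 <= (1 - u / 2) ^+ r.-1.
  have hx : 0 <= u / 2 by lra.
  have hx1 : u / 2 <= 1 by lra.
  apply: le_trans (ge_1Mx_exprn r.-1 hx hx1).
  have : r.-1%:R * (u / 2) <= r%:R * (u / 2) by apply: ler_wpM2r => //; rewrite ler_nat leq_pred.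
  have -> : r%:R * (u / 2) = 1 / 2 by rewrite mulrA ru.
  lra.
have p0 : 0 < n ^+ r.-1 by rewrite exprn_gt0.
have h3 : n ^+ r.-1 / 2 <= #|U|%:R ^+ r.-1.
  apply: (@le_trans _ _ (((1 - u / 2) * n) ^+ r.-1)).
    by rewrite exprMn mulrC ler_pM2r.
  have hh : 0 <= (1 - u / 2) * n by apply: mulr_ge0; lra.
  by rewrite lerXn2r ?nnegrE // (le_trans hh hU).
have v0 : 0 < u ^+ r.-1 by rewrite exprn_gt0.
have v6 : 0 < u ^+ 6 by rewrite exprn_gt0.
rewrite subn1 h1 exprMn.
apply: (@lt_le_trans _ _ (n ^+ r.-1 * (u ^+ r.-1 * u ^+ 6))).
  rewrite -mulrA -[ltRHS]mul1r ltr_pM2r ?mulr_gt0 // ltrBlDr ltrDl.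
  by rewrite divr_gt0 // exprn_gt0.
have := ler_wpM2r (ltW (mulr_gt0 v0 v6)) h3; lra.
Qed.

(** With [D = (u + u ^ 4) * #|U|] the defect is [t = u ^ 3 * #|U|]. Without (r+1)-cliques,
    [(r + 2) * t < D] reads [u ^ 2 + 2 * u ^ 3 < u + u ^ 4], true for [u <= 1 / 2]; otherwise
    [js_ge_of_clique] applies. *)
Lemma colorable_or_js_large U :
  0 < n -> (1 - u / 2) * n <= #|U|%:R ->
  {in U, forall x, #|non_nbrs e U x|%:R <= (u + u ^+ 4) * #|U|%:R} ->
  (1 - 1 / r%:R ^+ 3) * n ^+ (r - 1)%N / r%:R ^+ (r + 5)%N < (js_2r2 e r)%:R \/
  induced_colorable e U r.
Proof.
move=> n0 hU hD; have [u0 u1] := inv_bounds.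
have r0 : 2 <= r%:R :> R by rewrite ler_nat.
have N0 : 0 < #|U|%:R :> R by apply: lt_le_trans hU; rewrite mulr_gt0 //; lra.
have u2 : 0 < u ^+ 2 by rewrite exprn_gt0.
have u3 : 0 < u ^+ 3 by rewrite exprn_gt0.
have u4 : 0 < u ^+ 4 by rewrite exprn_gt0.
have u6 : 0 < u ^+ 6 by rewrite exprn_gt0.
have u21 : u ^+ 2 <= u / 2 by rewrite expr2 ler_wpM2l //; lra.
have D0 : 0 < (u + u ^+ 4) * #|U|%:R by rewrite mulr_gt0 // addr_gt0.
have tE : r%:R * ((u + u ^+ 4) * #|U|%:R) - #|U|%:R = u ^+ 3 * #|U|%:R.
  rewrite mulrA (_ : r%:R * (u + u ^+ 4) = (r%:R * u) * (1 + u ^+ 3)); last by ring.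
  by rewrite ru; ring.
have [/eqP h0|hne] := boolP (cliques e U r.+1 == set0).
  right; apply: (clique_free_colorable e_sym e_irr D0 hD h0 r_ge2).
  rewrite tE mulrA ltr_pM2r //.
  have -> : (r%:R + 2) * u ^+ 3 = (r%:R * u) * u ^+ 2 + 2 * u ^+ 3 by ring.
  have -> : u ^+ 3 = u * u ^+ 2 by ring.
  have : u * u ^+ 2 <= u * (u / 2) by rewrite ler_wpM2l // ltW.
  rewrite ru; nra.
left; apply: (js_large n0 hU).
have := js_ge_of_clique e_sym e_irr r_ge2 (ltW D0) hD hne; rewrite tE.
set N : R := #|U|%:R in N0 D0 *.
have -> : 2 * ((u + u ^+ 4) * N) - (r%:R - 1) * (r%:R + 2) * (u ^+ 3 * N) =
   (2 * u + 2 * u ^+ 4 - ((r%:R * u) ^+ 2 * u + (r%:R * u) * u ^+ 2 - 2 * u ^+ 3)) * N.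
  by ring.
rewrite ru => hjs.
(* The left side is [(r - 1) * r * (r + 1) * 2 * u ^ 7]: the constant required by [js_large], with
   one factor [u] taken from the power of [N * u]. *)
have c0 : 2 * u ^+ 4 - 2 * u ^+ 6 <=
          2 * u + 2 * u ^+ 4 - (1 ^+ 2 * u + 1 * u ^+ 2 - 2 * u ^+ 3) by lra.
have c1 : 0 <= 2 * u ^+ 4 - 2 * u ^+ 6.
  have -> : 2 * u ^+ 4 - 2 * u ^+ 6 = 2 * u ^+ 4 * (1 - u ^+ 2) by ring.
  by rewrite mulr_ge0 //; lra.
have q0 : 0 < (r%:R - 1) * (r%:R * (r%:R + 1)) :> R by rewrite !mulr_gt0 //; lra.
rewrite -(ler_pM2l q0); apply: le_trans (hjs _); last first.
  by apply: mulr_ge0 (ltW N0); apply: le_trans c0.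
have -> : r.-1 = (r - 2).+1 by rewrite -subSn // subSS subn1.
have -> : (r%:R - 1) * (r%:R * (r%:R + 1)) * (2 * u ^+ 6 * (N * u) ^+ (r - 2).+1) =
   2 * ((r%:R * u) ^+ 3 * u ^+ 4 - (r%:R * u) * u ^+ 6) * N * (N * u) ^+ (r - 2).
  by rewrite [(N * u) ^+ (r - 2).+1]exprS; ring.
rewrite ru; have hp : (N * u) ^+ (r - 2) <= ((u + u ^+ 4) * N) ^+ (r - 2).
  have hNu : 0 <= N * u by rewrite mulr_ge0 // ltW.
  have hle : N * u <= (u + u ^+ 4) * N.
    have := mulr_gt0 u4 N0; lra.
  by rewrite lerXn2r ?nnegrE // (le_trans hNu hle).
apply: ler_pM => //.
- by apply: mulr_ge0 (ltW N0); lra.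
- by rewrite exprn_ge0 // mulr_ge0 // ltW.
- by rewrite ler_pM2r //; lra.
Qed.

(** Supersaturation with [g = u ^ 5 / 4]: its factor [2 * g * r = u ^ 4 / 2] is at least
    [2 * u ^ 6]. *)
Lemma dense_js_large U :
  0 < n -> (1 - u / 2) * n <= #|U|%:R ->
  (1 - u + u ^+ 5 / 2) * #|U|%:R ^+ 2 <= deg_sum U ->
  (1 - 1 / r%:R ^+ 3) * n ^+ (r - 1)%N / r%:R ^+ (r + 5)%N < (js_2r2 e r)%:R.
Proof.
move=> n0 hU hE; have [u0 u1] := inv_bounds.
have r0 : 0 < r%:R :> R by rewrite ltr0n ltnW.
have uE : r%:R^-1 = u by apply: (mulfI (lt0r_neq0 r0)); rewrite ru mulfV ?lt0r_neq0.
have N0 : 0 < #|U|%:R :> R by apply: lt_le_trans hU; rewrite mulr_gt0 //; lra.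
have g0 : 0 <= u ^+ 5 / 4 by rewrite divr_ge0 // exprn_ge0 // ltW.
have hg : (1 - 1 / r%:R + 2 * (u ^+ 5 / 4)) * #|U|%:R ^+ 2 <= deg_sum U.
  by apply: le_trans hE; rewrite div1r uE ler_wpM2r ?exprn_ge0 //; lra.
have := supersaturation e_sym e_irr (ltnW r_ge2) g0 _ hg; rewrite uE.
rewrite -(ltr0n R) => /(_ N0) hjs; apply: (js_large n0 hU); apply: le_trans hjs.
apply: ler_wpM2r; first by rewrite exprn_ge0 // mulr_ge0 // ltW.
have -> : 2 * (u ^+ 5 / 4) * r%:R = (r%:R * u) * (u ^+ 4 / 2) by field.
rewrite ru mul1r (_ : 2 * u ^+ 6 = u ^+ 4 * (2 * u ^+ 2)); last by ring.
apply: ler_wpM2l; first by rewrite exprn_ge0 // ltW.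
have : u ^+ 2 <= (1 / 2) ^+ 2 by rewrite lerXn2r ?nnegrE //; lra.
lra.
Qed.

Lemma colorable_deg_sum_le U :
  induced_colorable e U r -> deg_sum U <= (1 - u) * #|U|%:R ^+ 2.
Proof.
case=> f hf; have r0 : 0 < r%:R :> R by rewrite ltr0n ltnW.
have := colorable_deg_bound (ltnW r_ge2) hf.
move/(leq_trans (leq_addr _ _)); rewrite -(ler_nat R) natrM natrM natrX natrB ?(ltnW r_ge2) //.
move=> h; rewrite -(ler_pM2l r0); apply: le_trans h _.
have -> : r%:R * ((1 - u) * #|U|%:R ^+ 2) = (r%:R - r%:R * u) * #|U|%:R ^+ 2 by ring.
by rewrite ru.
Qed.

(* The slack 1 covers the deletion of a single vertex in the final argument. *)
Lemma dense_colorable U0 :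
  (r ^ 8 < #|T|)%N ->
  (forall U, (1 - u / 2) * n <= #|U|%:R ->
     {in U, forall x, #|non_nbrs e U x|%:R <= (u + u ^+ 4) * #|U|%:R} ->
     induced_colorable e U r) ->
  (forall U, (1 - u / 2) * n <= #|U|%:R ->
     deg_sum U < (1 - u + u ^+ 5 / 2) * #|U|%:R ^+ 2) ->
  (1 - u / 24) * n <= #|U0|%:R ->
  (1 - u) * #|U0|%:R ^+ 2 - 1 <= deg_sum U0 ->
  induced_colorable e U0 r.
Proof.
move=> hn hA hB hU0 hE0.
have [u0 u1] := inv_bounds.
have r0 : 0 < r%:R :> R by rewrite ltr0n ltnW.
have u4 : 0 < u ^+ 4 by rewrite exprn_gt0.
have u5 : 0 < u ^+ 5 by rewrite exprn_gt0.
have n256 : 256 <= n.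
  rewrite ler_nat; apply: leq_trans (ltnW hn).
  by rewrite (_ : 256%N = (2 ^ 8)%N) // leq_exp2r.
have nu8 : 1 <= n * u ^+ 8.
  have : r%:R ^+ 8 <= n by rewrite -natrX ler_nat ltnW.
  move/(ler_wpM2r (exprn_ge0 8 (ltW u0))).
  by rewrite -exprMn ru expr1n.
have u4le : u ^+ 4 <= 1 / 16.
  have -> : 1 / 16 = (1 / 2) ^+ 4 :> R by field.
  by rewrite lerXn2r ?nnegrE //; lra.
have nu4 : 16 <= n * u ^+ 4.
  have h : n * u ^+ 8 <= (n * u ^+ 4) * (1 / 16).
    have -> : n * u ^+ 8 = (n * u ^+ 4) * u ^+ 4 by ring.
    by rewrite ler_wpM2l // mulr_ge0 // ltW.
  lra.
(* [beta < u ^ 4] leaves room for rounding in the degree bound, while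
   [17 / 24 * u * beta > u ^ 5 / 2] is what makes a small maximiser too dense. *)
pose beta : R := 3 / 4 * u ^+ 4.
pose Phi U : R := deg_sum U - (1 - u - beta) * #|U|%:R ^+ 2.
pose P U := (U \subset U0) && ((1 - u / 2) * n <= #|U|%:R).
have hn0 : 0 <= n by [].
have P0 : P U0.
  rewrite /P subxx /=; apply: le_trans hU0; apply: ler_wpM2r => //; lra.
case: (arg_maxP Phi P0) => U /andP[UU0 hU] Umax.
have PhiU : Phi U0 <= Phi U by apply: Umax.
have cUU0 : #|U|%:R <= #|U0|%:R :> R by rewrite ler_nat subset_leq_card.
set N : R := #|U|%:R in hU cUU0 *; set N0 : R := #|U0|%:R in hE0 hU0 cUU0 *.
have hPhi : (1 - u) * N ^+ 2 - 1 + beta * (N0 ^+ 2 - N ^+ 2) <= deg_sum U.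
  move: PhiU; rewrite /Phi -/N -/N0; lra.
have bt0 : 0 < beta by rewrite /beta mulr_gt0 //; lra.
have hN : 0 < N by apply: lt_le_trans hU; rewrite mulr_gt0 //; lra.
(* A small maximiser is one from which no vertex can be deleted within [P]. Then
   [N0 - N >= 5 / 12 * u * n] and [N0 + N >= 17 / 10 * n], so the gain [beta * (N0 ^ 2 - N ^ 2)]
   contradicts [hB]. *)
have [small|big] := ltP (N - 1) ((1 - u / 2) * n).
  have := hB U hU; rewrite -/N ltNge => /negP; case; apply: le_trans hPhi.
  have u3 : u ^+ 3 <= 1 / 8.
    have -> : 1 / 8 = (1 / 2) ^+ 3 :> R by field.
    by rewrite lerXn2r ?nnegrE //; lra.
  have nu : 128 <= n * u.
    have : (n * u) * u ^+ 3 <= (n * u) * (1 / 8).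
      by rewrite ler_wpM2l // mulr_ge0 // ltW.
    rewrite (_ : n * u * u ^+ 3 = n * u ^+ 4); last by ring.
    lra.
  have hN1 : N <= (1 - 11 / 24 * u) * n by lra.
  have h1 : 17 / 24 * u * n ^+ 2 <= N0 ^+ 2 - N ^+ 2.
    rewrite subr_sqr.
    have un : u * n <= 1 / 2 * n by rewrite ler_wpM2r.
    have h : (5 / 12 * u * n) * (17 / 10 * n) <= (N0 - N) * (N0 + N).
      apply: ler_pM; [by rewrite !mulr_ge0 //; lra|by rewrite mulr_ge0 //; lra| |]; lra.
    move: h; lra.
  have h2 := ler_wpM2l (ltW bt0) h1.
  have h3 : N ^+ 2 <= n ^+ 2.
    by rewrite lerXn2r ?nnegrE // ?(ltW hN) // ler_nat max_card.
  have h4 : 256 <= n ^+ 2 * u ^+ 5.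
    have -> : n ^+ 2 * u ^+ 5 = (n * u) * (n * u ^+ 4) by ring.
    have : 128 * 16 <= (n * u) * (n * u ^+ 4) by apply: ler_pM.
    lra.
  have h5 := ler_wpM2l (ltW u5) h3.
  have h6 : beta * (17 / 24 * u * n ^+ 2) = 17 / 32 * (n ^+ 2 * u ^+ 5).
    by rewrite /beta; lra.
  lra.
(* Deleting [x] stays within [P] and cannot increase [Phi], so [2 * deg x >= (1 - u - beta) * (2 * N
   - 1)]. *)
have colU : induced_colorable e U r.
  apply: hA => // x xU; rewrite -/N.
  have hP : P (U :\ x).
    rewrite /P (subset_trans (subsetDl _ _) UU0) /=.
    move: big; rewrite /N (cardsD1 x U) xU natrD /=; lra.
  have hmax : Phi (U :\ x) <= Phi U by apply: Umax.
  move: hmax; rewrite /Phi -/N => hmax.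
  have cD : #|U :\ x|%:R = N - 1 by rewrite /N (cardsD1 x U) xU natrD /=; ring.
  have xU1 : [set x] \subset U by rewrite sub1set.
  have := sum_deg_in_setD e_sym xU1; rewrite big_set1 -(ler_nat R) natrD natrM => hdel.
  have hdeg : #|non_nbrs e U x|%:R = N - (deg_in e U x)%:R :> R.
    by rewrite /N -(card_non_nbrs e U x) natrD; ring.
  rewrite hdeg; move: hmax; rewrite cD => hmax.
  have h1 : 2 * (deg_in e U x)%:R >= (1 - u - beta) * (2 * N - 1) by lra.
  have h2 : 12 <= N * u ^+ 4.
    have := ler_wpM2r (ltW u4) hU.
    have : 0 <= (1 / 4 - u / 2) * (n * u ^+ 4) by rewrite mulr_ge0 //; lra.
    lra.
  have h3 : 0 <= u + beta by lra.
  move: h1; rewrite /beta; lra.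
have := colorable_deg_sum_le colU; rewrite -/N => hc.
have [<-//|neq] := eqVneq U U0.
have : (#|U| < #|U0|)%N by rewrite proper_card // properEneq neq.
rewrite -(ler_nat R) -natr1 -/N -/N0 => hlt.
(* One missing vertex already makes [beta * (N0 ^ 2 - N ^ 2)] exceed the slack 1, against the Turan
   bound [hc] for [U]. *)
have h1 : N0 <= N0 ^+ 2 - N ^+ 2.
  rewrite subr_sqr; have : 0 <= (N0 - N - 1) * (N0 + N) by apply: mulr_ge0; lra.
  lra.
have h2 := ler_wpM2l (ltW bt0) h1.
have h3 := ler_wpM2l (ltW bt0) hU0.
have h4 : beta * ((1 - u / 24) * n) = 3 / 4 * (n * u ^+ 4) * (1 - u / 24) by rewrite /beta; ring.
have h5 : 0 <= (n * u ^+ 4 - 16) * (1 - u / 24) by apply: mulr_ge0; lra.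
exfalso; lra.
Qed.

End Stability.

(** * Integrality when one vertex is deleted *)

Lemma leq_of_ltn_mulS r q d :
  (0 < r -> r * d < r.-1 * (q * r).+1 -> d <= r.-1 * q)%N.
Proof.
case: r => // r _ /= h; rewrite leqNgt; apply/negP => hd.
have : (r.+1 * (r * q).+1 <= r.+1 * d)%N by rewrite leq_mul2l hd orbT.
nia.
Qed.

(** The difference of the two sides is [(s - 1) * (r - s - 1)]. *)
Lemma leq_pred_mul_subn r s : (0 < s -> s < r -> r.-1 <= s * (r - s))%N.
Proof. nia. Qed.

(* Integrality matters only here: if r divides #|T| - 1, then r * deg v is at most
   (r - 1) * (#|T| - 1) as soon as it is less than (r - 1) * #|T|. *)
Lemma colorable_setC1_deg (R : realFieldType) (T : finType) (e : rel T) (r : nat)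
    (v : T) (a : R) :
  symmetric e -> (2 <= r)%N -> induced_colorable e (setT :\ v) r ->
  0 < a -> a < 1 / 2 ->
  (r%:R - 1) * #|T|%:R ^+ 2 - 2 * r%:R * a ^+ 2 <
    r%:R * (\sum_(x in [set: T]) deg_in e setT x)%:R ->
  (r%:R - 1) * #|T|%:R - 4 * r%:R * a < r%:R * (deg_in e setT v)%:R.
Proof.
move=> e_sym r2 [f hf] a0 a1 hE; rewrite ltNge; apply/negP => hd.
have rR : 2 <= r%:R :> R by rewrite ler_nat.
have := colorable_deg_bound (ltnW r2) hf.
have := sum_deg_in_setD e_sym (subsetT [set v]); rewrite big_set1 => hdel.
set N := #|setT :\ v|; set s := (N %% r)%N => hc.
have nE : #|T| = N.+1 by rewrite -cardsT (cardsD1 v) inE.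
have rE : r%:R - 1 = r.-1%:R :> R by rewrite -subn1 natrB // ltnW.
move: hE hd; rewrite nE rE -(natr1 N) => hE hd.
have ra2 : 0 < r%:R * a by rewrite mulr_gt0 //; lra.
have raa : r%:R * a ^+ 2 <= r%:R * a * (1 / 2).
  by rewrite expr2 mulrA ler_wpM2l // ltW.
have hc' : r%:R * (\sum_(x in setT :\ v) deg_in e (setT :\ v) x)%:R + (s * (r - s))%:R <=
    r.-1%:R * N%:R ^+ 2 :> R.
  by rewrite -natrX -!natrM -natrD ler_nat -subn1.
have hdel' : r%:R * (\sum_(x in [set: T]) deg_in e setT x)%:R <=
    r%:R * (\sum_(x in setT :\ v) deg_in e (setT :\ v) x)%:R +
    2 * (r%:R * (deg_in e setT v)%:R) :> R.
  rewrite mulrCA -mulrDr ler_wpM2l // -natrM -natrD ler_nat; exact: hdel.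
set d := deg_in e setT v in hd hdel'.
have hmain : r.-1%:R * (2 * N%:R + 1) + (s * (r - s))%:R - 2 * r%:R * a ^+ 2 < 2 * (r%:R * d%:R).
  lra.
(* If r divides [N], integrality lowers the bound on [r * d] to [(r - 1) * N], and [hmain] would
   force [r - 1 < r / 2]. Otherwise the Turan correction [s * (r - s) >= r - 1] suffices. *)
have [s0|s0] := posnP s.
  have [q Nq] : exists q, N = (q * r)%N.
    by exists (N %/ r)%N; rewrite {1}(divn_eq N r) -/s s0 addn0.
  have hrd : (r * d < r.-1 * (q * r).+1)%N.
    by rewrite -Nq -(ltr_nat R) !natrM -natr1; lra.
  have : (r * d <= r.-1 * (q * r))%N.
    have := leq_of_ltn_mulS (ltnW r2) hrd.
    by rewrite [(q * r)%N]mulnC mulnCA leq_mul2l => ->; rewrite orbT.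
  rewrite -Nq -(ler_nat R) !natrM => h; move: hmain; rewrite s0 mul0n => hmain.
  have : r.-1%:R = r%:R - 1 :> R by rewrite rE.
  have : r%:R * a <= r%:R * (1 / 2) by rewrite ler_wpM2l // ltW.
  lra.
have hs : (r.-1 <= s * (r - s))%N.
  by apply: (leq_pred_mul_subn s0); rewrite ltn_mod ltnW.
move: hs; rewrite -(ler_nat R) => hs; lra.
Qed.

(** * The dichotomy by the number of low vertices *)

Unset Implicit Arguments.

Theorem theorem8 (R : realType) (T : finType) (e : rel T) (r : nat) (alpha : R) :
  simple_graph e ->
  (2 <= r)%N ->
  (r ^ 8 < #|T|)%N ->
  0 < alpha -> alpha < 1 / (36 * (r%:R) ^+ 8) ->
  ((num_edges e)%:R : R) > ((r%:R - 1) / (2 * r%:R) - alpha) * (#|T|%:R) ^+ 2 ->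
  ((js_2r2 e r)%:R : R) > (1 - 1 / (r%:R) ^+ 3) * (#|T|%:R) ^+ (r - 1)%N / (r%:R) ^+ (r + 5)%N
  \/
  exists S : {set T},
    [/\ induced_colorable e S r,
        #|S|%:R >= (1 - 2 * Num.sqrt alpha) * #|T|%:R
      & forall x, x \in S ->
          (deg_in e S x)%:R > (1 - 1 / r%:R - 6 * Num.sqrt alpha) * #|T|%:R].
Proof.
move=> [e_sym e_irr] r2 hn alpha0 alpha_lt hE.
set J := (X in X < _ \/ _).
have [hJ|hJ] := ltP J (js_2r2 e r)%:R; [by left|right].
have r0 : 0 < r%:R :> R by rewrite ltr0n ltnW.
set u := 1 / r%:R : R.
have ru : r%:R * u = 1 by rewrite /u mulrC divfK ?lt0r_neq0.
have [u0 u1] := inv_bounds r2 ru.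
set n : R := #|T|%:R in hE *.
have n0 : 0 < n by rewrite ltr0n; apply: leq_ltn_trans hn.
have nR : r%:R ^+ 8 <= n by rewrite -natrX ler_nat ltnW.
set s := Num.sqrt alpha.
have s0 : 0 < s by rewrite sqrtr_gt0.
have s2 : s ^+ 2 = alpha by rewrite sqr_sqrtr // ltW.
have u4 : 0 < u ^+ 4 by rewrite exprn_gt0.
have u3 : u ^+ 3 <= 1 / 8.
  have -> : 1 / 8 = (1 / 2) ^+ 3 :> R by field.
  by rewrite lerXn2r ?nnegrE //; lra.
have u43 : u ^+ 4 <= u / 8.
  have -> : u ^+ 4 = u * u ^+ 3 by ring.
  have := ler_wpM2l (ltW u0) u3; lra.
(* This is the upper bound on [alpha] after taking square roots. *)
have su : 6 * s < u ^+ 4.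
  rewrite -(ltr_pXn2r (n := 2)) ?nnegrE //; [|by rewrite mulr_ge0 // ltW|exact: ltW].
  rewrite exprMn s2; have : alpha < u ^+ 8 / 36.
    apply: lt_le_trans alpha_lt _; rewrite le_eqVlt; apply/orP; left; apply/eqP.
    rewrite /u expr_div_n expr1n; field; exact: lt0r_neq0.
  rewrite (_ : u ^+ 8 = (u ^+ 4) ^+ 2); last by ring.
  lra.
(* Ensures that even [m = 1] satisfies [m <= u / 24 * n], the deletion allowed by
   [dense_colorable]. *)
have nu : 24 <= u * n.
  have h : u * r%:R ^+ 8 <= u * n by rewrite ler_wpM2l // ltW.
  apply: le_trans h; rewrite exprS mulrA [u * _]mulrC ru mul1r.
  by rewrite -natrX ler_nat; apply: leq_trans (_ : 2 ^ 7 <= _)%N; rewrite // leq_exp2r.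
have hA (U : {set T}) : (1 - u / 2) * n <= #|U|%:R ->
    {in U, forall x, #|non_nbrs e U x|%:R <= (u + u ^+ 4) * #|U|%:R} ->
    induced_colorable e U r.
  move=> hU hD; case: (colorable_or_js_large e_sym e_irr r2 ru n0 hU hD) => //.
  by rewrite ltNge hJ.
have hB (U : {set T}) : (1 - u / 2) * n <= #|U|%:R ->
    (\sum_(x in U) deg_in e U x)%:R < (1 - u + u ^+ 5 / 2) * #|U|%:R ^+ 2.
  move=> hU; rewrite ltNge; apply/negP => h.
  by have := dense_js_large e_sym e_irr r2 ru n0 hU h; rewrite ltNge hJ.
have hV : (1 - u - 2 * s ^+ 2) * n ^+ 2 < (\sum_(x in [set: T]) deg_in e setT x)%:R.
  rewrite sum_deg_in // -num_edges_cliques natrM s2.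
  have e1 : (r%:R - 1) / (2 * r%:R) = (1 - u) / 2 :> R.
    by rewrite /u; field; exact: lt0r_neq0.
  move: hE; rewrite e1; lra.
pose M := [set x : T | (deg_in e setT x)%:R <= (1 - u - 4 * s) * n].
have sn0 : 0 < s * n by rewrite mulr_gt0.
have sn1 : 6 * (s * n) <= u * n / 8.
  have : (6 * s) * n <= (u / 8) * n by rewrite ler_wpM2r // ltW //; lra.
  lra.
have [Msmall|Mbig] := leP #|M|%:R (2 * (s * n)).
  have cS : #|~: M|%:R = n - #|M|%:R :> R.
    by rewrite /n -(cardsC M) natrD; ring.
  have hdeg x : x \in ~: M -> (1 - u - 6 * s) * n < (deg_in e (~: M) x)%:R.
    rewrite !inE -ltNge => hx.
    have : (deg_in e setT x <= deg_in e (~: M) x + #|M|)%N.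
      rewrite /deg_in -(cardsID (~: M) [set y in setT | e x y]); apply: leq_add.
        by apply: subset_leq_card; apply/subsetP => y; rewrite !inE andbC.
      by apply: subset_leq_card; apply/subsetP => y; rewrite !inE negbK => /andP[].
    rewrite -(ler_nat R) natrD; lra.
  exists (~: M); split=> //; last by rewrite cS; lra.
  (* Since [6 * s < u ^ 4] and [#|~: M| <= n], the bound [hdeg] leaves at most
     [(u + u ^ 4) * #|~: M|] non-neighbours. *)
  apply: hA => [|x xS]; first by rewrite cS; lra.
  have := hdeg x xS.
  have := card_non_nbrs e (~: M) x => /(congr1 (fun k => k%:R : R)); rewrite natrD.
  have cSn : #|~: M|%:R <= n by rewrite ler_nat max_card.
  have : 0 <= (1 - u - u ^+ 4) * (n - #|~: M|%:R) by apply: mulr_ge0; lra.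
  have : 6 * s * n <= u ^+ 4 * n by rewrite ler_wpM2r // ltW.
  lra.
(* The integer part of [2 * (s * n)] is at least [s * n] once it is positive; below that range a
   single vertex is deleted. *)
have [m [m0 mM m_le hm]] : exists m : nat, [/\ (0 < m)%N, (m <= #|M|)%N, m%:R <= u / 24 * n &
    (s * n <= m%:R /\ m%:R <= 2 * (s * n)) \/ (m = 1%N /\ s * n < 1 / 2)].
  have [big|small] := leP (1 / 2) (s * n); last first.
    exists 1%N; split=> //; [|lra|by right].
    rewrite -(ltr0n R); lra.
  have h0 : 0 <= 2 * (s * n) by lra.
  have /andP[h1 h2] := Num.Theory.truncn_itv h0.
  exists (Num.truncn (2 * (s * n))).
  have m1 : (0 < Num.truncn (2 * (s * n)))%N.
    rewrite -ltnS -(ltr_nat R); apply: le_lt_trans h2; lra.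
  split=> //.
  - by rewrite -(ler_nat R); lra.
  - lra.
  - left; split=> //; move: m1 h2; rewrite -(ler_nat R) -natr1; lra.
have [M' [M'M cM']] : exists M' : {set T}, M' \subset M /\ #|M'| = m.
  have [t [ut st tM]] := card_geqP mM.
  exists [set x in t]; split; first by apply/subsetP => x; rewrite inE => /tM.
  by rewrite cardsE -st; apply/card_uniqP.
set U0 := setT :\: M'.
have cU0 : #|U0|%:R = n - m%:R :> R.
  by rewrite /U0 setTD /n -(cardsC M') cM' natrD; ring.
have hdel : (\sum_(x in [set: T]) deg_in e setT x)%:R <=
   (\sum_(x in U0) deg_in e U0 x)%:R + 2 * (m%:R * ((1 - u - 4 * s) * n)) :> R.
  have := sum_deg_in_setD e_sym (subsetT M'); rewrite -(ler_nat R) natrD natrM => h.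
  apply: le_trans h _; rewrite lerD2l ler_pM2l // natr_sum -cM' mulr_natl -sumr_const.
  by apply: ler_sum => x /(subsetP M'M); rewrite inE.
have hU0 : (1 - u) * #|U0|%:R ^+ 2 - 2 * (s * n) ^+ 2 + 8 * (s * n) * m%:R - (1 - u) * m%:R ^+ 2
   < (\sum_(x in U0) deg_in e U0 x)%:R.
  rewrite cU0; lra.
have colU0 : (1 - u) * #|U0|%:R ^+ 2 - 1 <= (\sum_(x in U0) deg_in e U0 x)%:R ->
    induced_colorable e U0 r.
  apply: (dense_colorable e_sym r2 ru hn hA hB); rewrite cU0 -/n; lra.
case: hm => [[m_ge m_le2]|[m1 sn_lt]].
  (* For [s * n <= m <= 2 * (s * n)] the surplus in [hU0] is nonnegative, so [U0] strictly beats the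
     Turan bound and cannot be r-colourable. *)
  have hpos : 0 <= - 2 * (s * n) ^+ 2 + 8 * (s * n) * m%:R - (1 - u) * m%:R ^+ 2.
    have h1 : 0 <= (m%:R - s * n) * (s * n) by rewrite mulr_ge0 //; lra.
    have h2 : 0 <= (2 * (s * n) - m%:R) * m%:R by rewrite mulr_ge0 //; lra.
    have h3 : 0 <= u * m%:R ^+ 2 by rewrite mulr_ge0 ?exprn_ge0 // ltW.
    have h4 : 0 <= (s * n) * m%:R by rewrite mulr_ge0 // ltW.
    lra.
  have hc := colU0 _; have := colorable_deg_sum_le (R := R) r2 ru (hc _); lra.
(* With [m = 1] the surplus may be negative, but it is above -1. So [U0] is r-colourable, and
   [colorable_setC1_deg] with [a = s * n] shows that [v] is not low. *)
have [v vM'] : exists v, M' = [set v] by apply/cards1P; rewrite cM' m1.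
have colv : induced_colorable e (setT :\ v) r.
  rewrite -vM' -/U0; apply: colU0; move: hU0; rewrite m1.
  have : (s * n) ^+ 2 <= s * n * (1 / 2) by rewrite expr2 ler_wpM2l // ltW.
  lra.
have := colorable_setC1_deg e_sym r2 colv sn0 sn_lt.
have dv : (deg_in e setT v)%:R <= (1 - u - 4 * s) * n.
  by have : v \in M; [apply: (subsetP M'M); rewrite vM' set11|rewrite inE].
have dvr := ler_wpM2l (ltW r0) dv.
have e1 : r%:R * ((1 - u - 4 * s) * n) = (r%:R - r%:R * u) * n - 4 * r%:R * (s * n) by ring.
have hVr : r%:R * ((1 - u - 2 * s ^+ 2) * n ^+ 2) <
    r%:R * (\sum_(x in [set: T]) deg_in e setT x)%:R by rewrite ltr_pM2l.
have e2 : r%:R * ((1 - u - 2 * s ^+ 2) * n ^+ 2) =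
    (r%:R - r%:R * u) * n ^+ 2 - 2 * r%:R * (s * n) ^+ 2 by ring.
rewrite e1 ru in dvr; rewrite e2 ru in hVr.
by move/(_ hVr); rewrite ltNge dvr.
Qed.
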